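(* Suppose $c\ge 2$, $n\ge 3$, $\frac{c-1}{2(c+1)}n>R>\sqrt{n\ln\left(\frac{c}{c-1}\right)}$, and let $r_1,\ldots,r_k$ be distinct integers with $|n/2-r_i|\le R$ for all $i$. Let $X_*$ be a Lipschitz function over $\{0,1\}^n$, and let $X$ be $X_*$ restricted to $C_{r_1,\ldots,r_k}$. Then for every $h\ge 0$, $$\mathbb{P}\big(X-\mathbb{E}(X_* )\ge h\big)<e^{(R+3)\ln(c)-\ln(k)-\frac{h^2}{2(n-1)}}.$$ In particular, if $n/6>R>\sqrt{n\ln(2)}$, then for every $h\ge0$, $$\mathbb{P}\big(X-\mathbb{E}(X_* )\ge h\big)<e^{(R+3)\ln(2)-\ln(k)-\frac{h^2}{2(n-1)}}.$$
   Context: Elements of $\{0,1\}^n$ are identified with subsets of $\{1,\ldots,n\}$, with the metric $d(A,B)=|A\triangle B|$ (Hamming distance). A function $X_*:\{0,1\}^n\to\mathbb{R}$ is Lipschitz if $|X_*(A)-X_*(B)|\le d(A,B)$ for all $A,B$. For an integer $s$, $C_s=\{A\in\{0,1\}^n:|A|=s\}$, and $C_{r_1,\ldots,r_k}=\bigcup_iC_{r_i}$. The function $X_*$ is regarded as a random variable under the uniform distribution on $\{0,1\}^n$ (so $\mathbb{E}(X_* )$ is its average over $\{0,1\}^n$), and $X$ as a random variable under the uniform distribution on $C_{r_1,\ldots,r_k}$. *)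

(* Defs.v *)
From mathcomp Require Import all_boot all_order all_algebra.
From mathcomp Require Import reals sequences exp.

Set Implicit Arguments.
Unset Strict Implicit.
Unset Printing Implicit Defensive.

Import Order.TTheory GRing.Theory Num.Theory.
Local Open Scope ring_scope.

(* Points of {0,1}^n are represented by the subsets of 'I_n = {0, ..., n-1}. *)
Definition hamming (n : nat) (A B : {set 'I_n}) : nat :=
  #|(A :\: B) :|: (B :\: A)|.

Definition hamming_lipschitz (R : realType) (n : nat) (X : {set 'I_n} -> R) :
    Prop :=
  forall A B : {set 'I_n}, `|X A - X B| <= (hamming A B)%:R.

Definition layer (n : nat) (s : int) : {set {set 'I_n}} :=
  [set A : {set 'I_n} | #|A|%:Z == s].

Definition layers (n k : nat) (r : 'I_k -> int) : {set {set 'I_n}} :=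
  \bigcup_(i < k) layer n (r i).

(* Expectation and probability under the uniform distribution on a finite set
   C; both are meaningful only when C is nonempty (they are 0 otherwise). *)
Definition uniform_mean (R : realType) (T : finType) (C : {set T})
    (f : T -> R) : R :=
  (\sum_(x in C) f x) / #|C|%:R.

Definition uniform_prob (R : realType) (T : finType) (C : {set T})
    (E : pred T) : R :=
  #|[set x in C | E x]|%:R / #|C|%:R.

(* Main.v *)
(* By Hoeffding's inequality on the cube, at most [2^n exp (- 2 h^2 / n)] sets
   deviate by [h], so it suffices to see that each of the [k] layers has more
   than [2^n / c^(rad + 3)] elements.  Let [M = floor (n / 2 + rad)].  Each
   layer in the window is at least as large as ['C(n, M)], and at least half of
   the cube lies at levels [>= n / 2].  From [n / 2] to [M], consecutive layers
   shrink by a factor at most [c], so this part has size at most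
   [2 c^rad 'C(n, M)].  Above [M], the telescoping sum of [(2 s - n) 'C(n, s)]
   bounds the tail by [n / (4 rad) 'C(n, M)], and the lower bound on [rad]
   gives [n <= c rad^2], because [ln (c / (c - 1)) >= 1 / c]. *)

Require Import Defs.
From mathcomp Require Import all_boot all_order all_algebra.
From mathcomp Require Import reals sequences exp.
From mathcomp Require Import topology normedtype.
From mathcomp Require Import zify ring lra.

Set Implicit Arguments.
Unset Strict Implicit.
Unset Printing Implicit Defensive.

Import Order.TTheory GRing.Theory Num.Theory.
Import numFieldNormedType.Exports.
Local Open Scope ring_scope.

(** * The bound cosh x <= exp(x^2/2) *)

Lemma double_factorial_leq m : (m`! * 2 ^ m <= (m.*2)`!)%N.
Proof.
elim: m => // m IH; rewrite doubleS !factS expnS.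
apply: leq_trans (_ : (m.*2.+2 * (m`! * 2 ^ m) <= _)%N); first by lia.
by rewrite leq_mul2l (leq_trans IH)// leq_pmull.
Qed.

(** Odd terms cancel. An even term x^(2m)/(2m)! is at most (x^2/2)^m/m! because m! 2^m <= (2m)!, and
    [uphalf n] counts the even indices below [n]. *)
Lemma cosh_coeff_partial_sum (R : realType) (x : R) n :
  series (exp_coeff x) n + series (exp_coeff (- x)) n
    <= 2 * series (exp_coeff (x ^+ 2 / 2)) (uphalf n).
Proof.
elim: n => [|n IH]; first by rewrite /= !seriesEnat /= !big_nil; lra.
rewrite (_ : uphalf n.+1 = n./2.+1)// !seriesSr.
have -> : exp_coeff (- x) n = (-1) ^+ n * exp_coeff x n.
  by rewrite /exp_coeff /= [in LHS]exprNn mulrA.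
rewrite uphalf_half in IH; rewrite -signr_odd; case: (boolP (odd n)) IH => [_|e].
  by rewrite expr1 add1n seriesSr; lra.
rewrite add0n expr0 => IH.
suff : exp_coeff x n <= exp_coeff (x ^+ 2 / 2) n./2 by lra.
rewrite /exp_coeff /= -{1 2}(even_halfK e).
rewrite -muln2 mulnC exprM expr_div_n -mulrA.
apply: ler_wpM2l; first by rewrite exprn_ge0// sqr_ge0.
rewrite -invfM lef_pV2 ?posrE ?mulr_gt0 ?ltr0n ?fact_gt0 ?exprn_gt0//.
by rewrite -natrX -natrM ler_nat [leqLHS]mulnC mul2n double_factorial_leq.
Qed.

Lemma cosh_le_expR_sqr (R : realType) (x : R) :
  expR x + expR (- x) <= 2 * expR (x ^+ 2 / 2).
Proof.
have cv (y : R) := is_cvg_series_exp_coeff y.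
rewrite /expR -limD //; apply: limr_le; first exact: is_cvgD.
near=> n; apply: le_trans (cosh_coeff_partial_sum x n) _.
rewrite ler_pM2l//; apply: nondecreasing_cvgn_le; last exact: cv.
apply/nondecreasing_series => m _ _.
by rewrite exp_coeff_ge0// divr_ge0// sqr_ge0.
Unshelve. all: by end_near. Qed.

(** * Hoeffding's inequality on the cube *)

Lemma big_powersetU1 (V : nmodType) (T : finType) (x : T) (D : {set T})
    (F : {set T} -> V) : x \notin D ->
  \sum_(A in powerset (x |: D)) F A
    = \sum_(A in powerset D) (F A + F (x |: A)).
Proof.
move=> xD; rewrite (bigID (fun A : {set T} => x \in A)) /= addrC big_split /=.
congr +%R.
  apply: eq_bigl => A; rewrite !inE; apply/andP/idP => [[AxD xA]|AD].
    by rewrite -(setU1K xD) subsetD1 AxD.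
  rewrite (subset_trans AD) ?subsetU1//; split=> //.
  by apply: contra xD => /(subsetP AD).
rewrite (reindex_onto (fun A => x |: A) (fun A => A :\ x)) /=; last first.
  by move=> A /andP[_ xA]; rewrite setD1K.
apply: eq_bigl => A; rewrite !inE eqxx andbT; apply/andP/idP => [[AxD /eqP <-]|AD].
  by rewrite -(setU1K xD) setSD.
have xA : x \notin A by apply: contra xD => /(subsetP AD).
by rewrite setUS// setU1K.
Qed.

(** Hoeffding's lemma for a fair two-point variable: factoring out the midpoint leaves 2 cosh d,
    where d^2/2 = l^2 (b - a)^2/8. *)
Lemma expR_two_point_mean (R : realType) (l a b : R) : `|b - a| <= 1 ->
  expR (l * a) + expR (l * b) <= 2 * expR (l * ((a + b) / 2) + l ^+ 2 / 8).
Proof.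
move=> ab; set m := (a + b) / 2; pose d := l * ((b - a) / 2).
have -> : l * a = l * m + - d by rewrite /m /d; field.
have -> : l * b = l * m + d by rewrite /m /d; field.
rewrite !expRD -mulrDr [leRHS]mulrCA ler_pM2l ?expR_gt0// [leLHS]addrC.
rewrite (le_trans (cosh_le_expR_sqr d))// ler_pM2l// ler_expR.
have : (b - a) ^+ 2 <= 1 by rewrite -real_normK ?num_real ?expr_le1.
have := sqr_ge0 l; rewrite /d; set u := l ^+ 2; set v := (b - a) ^+ 2 => u0 v1.
have -> : (l * ((b - a) / 2)) ^+ 2 / 2 = u * v / 8 by rewrite /u /v; field.
by have := ler_wpM2l u0 v1; lra.
Qed.

(* The induction averages out one coordinate of [D] at a time. *)
Lemma sum_expR_powerset (R : realType) (T : finType) (l : R) (D : {set T})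
    (f : {set T} -> R) :
  (forall x A, `|f (x |: A) - f A| <= 1) ->
  \sum_(A in powerset D) expR (l * f A)
    <= 2 ^+ #|D| * expR (l * ((\sum_(A in powerset D) f A) / 2 ^+ #|D|)
                         + l ^+ 2 / 8 * #|D|%:R).
Proof.
have [m] := ubnP #|D|; elim: m => // m IH in D f *; rewrite ltnS => Dm lf.
have [->|[x xD]] := set_0Vmem D.
  rewrite powerset0 !big_set1 cards0 expr0 mul1r divr1 mulr0 addr0.
  by [].
have Em : (#|D :\ x| < m)%N by rewrite (cardsD1 x D) xD in Dm.
have xE : x \notin D :\ x by rewrite setD11.
rewrite -(setD1K xD); move: (D :\ x) xE Em => E xE Em.
pose g A := (f A + f (x |: A)) / 2.
(* Adding [y] commutes with adding [x], so the average [g] inherits the increment bound from the two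
   functions it averages. *)
have lg y A : `|g (y |: A) - g A| <= 1.
  have := lf y A; have := lf y (x |: A); rewrite setUCA /g.
  by rewrite !ler_norml => /andP[? ?] /andP[? ?]; apply/andP; split; lra.
rewrite !big_powersetU1// cardsU1 xE add1n (exprS 2 #|E|) -natr1.
have -> : \sum_(A in powerset E) (f A + f (x |: A))
    = 2 * \sum_(A in powerset E) g A.
  by rewrite mulr_sumr; apply: eq_bigr => A _; rewrite /g; field.
apply: le_trans (_ : 2 * expR (l ^+ 2 / 8)
    * \sum_(A in powerset E) expR (l * g A) <= _).
  rewrite mulr_sumr; apply: ler_sum => A _.
  by rewrite -mulrA -expRD [_ + l * _]addrC expR_two_point_mean.
apply: le_trans (ler_wpM2l _ (IH E g Em lg)) _.
  by rewrite mulr_ge0 ?expR_ge0.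
rewrite mulrACA -expRD -mulf_div divff ?pnatr_eq0// mul1r.
by rewrite ler_pM2l ?mulr_gt0 ?exprn_gt0// ler_expR; lra.
Qed.

Lemma card_deviation_hypercube (R : realType) (T : finType) (f : {set T} -> R)
    (h : R) : (0 < #|T|)%N ->
  (forall x A, `|f (x |: A) - f A| <= 1) -> 0 <= h ->
  #|[set A | h <= f A - uniform_mean [set: {set T}] f]|%:R
    <= 2 ^+ #|T| * expR (- (2 * h ^+ 2 / #|T|%:R)).
Proof.
move=> T0 lf h0; set mu := uniform_mean _ f; set S := [set A | _].
pose N : R := #|T|%:R; have N0 : 0 < N by rewrite ltr0n.
(* Chernoff's method: this [l] minimises l^2 N/8 - l h, with minimum -2 h^2/N. *)
pose l := 4 * h / N; have l0 : 0 <= l by rewrite divr_ge0 ?mulr_ge0// ltW.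
have mE : mu = (\sum_(A in powerset [set: T]) f A) / 2 ^+ #|[set: T]|.
  rewrite /mu /uniform_mean -(powersetT T).
  by rewrite card_powerset natrX.
have := sum_expR_powerset l [set: T] lf; rewrite -mE cardsT => H.
have {H} : #|S|%:R * expR (l * (h + mu)) <= 2 ^+ #|T| * expR (l * mu + l ^+ 2 / 8 * N).
  apply: le_trans H; rewrite powersetT mulr_natl -sumr_const.
  apply: (@le_trans _ _ (\sum_(A in S) expR (l * f A))).
    apply: ler_sum => A; rewrite inE => hA.
    by rewrite ler_expR ler_wpM2l//; lra.
  rewrite big_mkcond [leRHS]big_mkcond; apply: ler_sum => A _ /=.
  by rewrite in_setT; case: ifP => _ //; rewrite expR_ge0.
rewrite -ler_pdivlMr ?expR_gt0// => /le_trans; apply.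
rewrite -[leLHS]mulrA -expRB ler_pM2l ?exprn_gt0// ler_expR le_eqVlt.
apply/orP; left; apply/eqP.
by rewrite /l -/N; field; rewrite gt_eqF.
Qed.

(** * Binomial coefficients from the middle level upwards *)

Lemma leq_bin_above_half n s t : (n <= s.*2)%N -> (s <= t)%N ->
  ('C(n, t) <= 'C(n, s))%N.
Proof.
move=> ns /subnK <-; elim: (t - s)%N => // d; apply: leq_trans.
have := mul_bin_left n (d + s); rewrite addSn.
set a := 'C(n, _); set b := 'C(n, _) => E.
by rewrite -(@leq_pmul2l (d + s).+1)// E leq_mul2r; apply/orP; right; lia.
Qed.

(** The reflection s -> n - s maps the levels below [uphalf n] injectively into the upper ones; for
    even [n] it misses the middle level, hence only an inequality. *)
Lemma exp2_leq_upper_half_sum n :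
  (2 ^ n <= 2 * \sum_(uphalf n <= s < n.+1) 'C(n, s))%N.
Proof.
have -> : (2 ^ n = \sum_(s < n.+1) 'C(n, s))%N.
  by rewrite (expnDn 1 1); apply: eq_bigr => i _; rewrite !exp1n !muln1.
rewrite (big_nat_widenl _ 0)//= big_mkord.
rewrite (bigID (fun s : 'I_n.+1 => (uphalf n <= s)%N)) /= mul2n -addnn leq_add2l.
rewrite (reindex_inj rev_ord_inj) /=.
rewrite [leqLHS]big_mkcond [leqRHS]big_mkcond; apply: leq_sum => s _ /=.
rewrite subSS bin_sub -1?ltnS//; do 2!case: ifP => //.
by rewrite uphalf_half; have := ltn_ord s; lia.
Qed.

(* The [- 1] is what makes the induction go through. *)
Lemma geometric_sum_le (R : realFieldType) (c : R) (g : nat -> R) m J :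
  2 <= c -> (forall s, 0 <= g s) ->
  (forall s, (m <= s < m + J)%N -> g s <= c * g s.+1) ->
  \sum_(m <= s < (m + J).+1) g s <= (2 * c ^+ J - 1) * g (m + J)%N.
Proof.
move=> c2 g0; elim: J => [|J IH] hg.
  by rewrite addn0 big_nat1 expr0; lra.
have g1 : g (m + J)%N <= c * g (m + J).+1 by apply: hg; lia.
rewrite addnS big_nat_recr /=; last by lia.
have cJ : 1 <= c ^+ J by apply: exprn_ege1; lra.
have {}IH : \sum_(m <= s < (m + J).+1) g s <= (2 * c ^+ J - 1) * g (m + J)%N.
  by apply: IH => s hs; apply: hg; lia.
have : (2 * c ^+ J - 1) * g (m + J)%N <= (2 * c ^+ J - 1) * (c * g (m + J).+1).
  by apply: ler_wpM2l => //; lra.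
have : 0 <= (c - 2) * g (m + J).+1 by apply: mulr_ge0; [lra|].
by rewrite exprSr; lra.
Qed.

(* Since [(s + 1) C(n, s + 1) = (n - s) C(n, s)], the sum of
   [(2 s - n) C(n, s)] telescopes. *)
Lemma upper_tail_bin_le (R : realFieldType) n M : (n <= M.*2.+2)%N -> (M <= n)%N ->
  (2 * (M%:R + 1) - n%:R) * \sum_(M.+1 <= s < n.+1) 'C(n, s)%:R
    <= (n%:R - M%:R) * 'C(n, M)%:R :> R.
Proof.
move=> nM Mn; pose u s : R := s%:R * 'C(n, s)%:R.
have uS s : (s <= n)%N -> u s.+1 = (n%:R - s%:R) * 'C(n, s)%:R.
  by move=> sn; rewrite /u -natrM mul_bin_left natrM natrB.
have un : u n.+1 = 0 by rewrite /u bin_small ?mulr0.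
have -> : (n%:R - M%:R) * 'C(n, M)%:R = - u n.+1 - - u M.+1.
  by rewrite un uS//; ring.
rewrite -(@GRing.telescope_sumr _ _ _ (fun s => - u s))// mulr_sumr.
rewrite big_nat [leRHS]big_nat; apply: ler_sum => s /andP[Ms sn].
rewrite uS// /u -subr_ge0.
have -> : - ((n%:R - s%:R) * 'C(n, s)%:R) - - (s%:R * 'C(n, s)%:R)
   - (2 * (M%:R + 1) - n%:R) * 'C(n, s)%:R
   = 2 * (s%:R - (M%:R + 1)) * 'C(n, s)%:R :> R by ring.
by rewrite !mulr_ge0// natr1 subr_ge0 ler_nat.
Qed.

Lemma ler_bin_step (R : realFieldType) (c : R) n s : (s < n)%N ->
  s%:R + 1 <= c * (n%:R - s%:R) -> 'C(n, s)%:R <= c * 'C(n, s.+1)%:R.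
Proof.
move=> sn hs; have ns : 0 < n%:R - s%:R :> R by rewrite subr_gt0 ltr_nat.
rewrite -(ler_pM2l ns) mulrA -natrB 1?ltnW// -natrM -mul_bin_left.
by rewrite natrM natrB 1?ltnW// -natr1 ler_wpM2r// mulrC.
Qed.

Lemma exp2_lt_bin (R : realType) (c rad : R) n s : 2 <= c -> 0 < rad ->
  rad < (c - 1) / (2 * (c + 1)) * n%:R -> n%:R <= c * rad ^+ 2 ->
  (s <= n)%N -> `|n%:R / 2 - s%:R| <= rad ->
  2 ^+ n < 'C(n, s)%:R * expR ((rad + 3) * ln c).
Proof.
move=> c2 rad0 radn nrad sn hs.
have c0 : 0 < c by lra.
have radn2 : 2 * rad * (c + 1) < (c - 1) * n%:R.
  have cp : 0 < 2 * (c + 1) by lra.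
  move: radn; rewrite -(ltr_pM2r cp).
  by rewrite (mulrAC _ n%:R) divfK ?gt_eqF//; lra.
(* Both the binomial coefficient and the distance to n/2 are invariant under s -> n - s. *)
wlog ns : s sn hs / (n <= s.*2)%N => [wl|].
  have [|ns] := leqP n s.*2; first exact: wl.
  rewrite -bin_sub//; apply: wl; [exact: leq_subr| |lia].
  by rewrite natrB// distrC; apply: le_trans hs; rewrite le_eqVlt; apply/orP; left;
    apply/eqP; congr `|_|; field.
pose M := Num.truncn (n%:R / 2 + rad).
have /andP[Mle Mlt] : M%:R <= n%:R / 2 + rad < M.+1%:R.
  by apply: truncn_itv; apply: addr_ge0; [rewrite divr_ge0|exact: ltW].
have sM : (s <= M)%N.
  rewrite -ltnS -(ltr_nat R); apply: le_lt_trans Mlt.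
  by move: hs; rewrite ler_norml => /andP[]; lra.
have Mn : (M <= n)%N.
  rewrite -ltnS -(ltr_nat R) -natr1.
  (* As c - 1 <= c + 1, the upper bound on [rad] puts n/2 + rad below n. *)
  have : 2 * rad * (c + 1) <= n%:R * (c + 1) by nra.
  by rewrite ler_pM2r; lra.
have nM : (n <= M.*2)%N by lia.
have [J MJ] : exists J, M = (uphalf n + J)%N.
  by exists (M - uphalf n)%N; rewrite uphalf_half; lia.
have JR : J%:R <= rad.
  have : n%:R / 2 <= (uphalf n)%:R :> R.
    by rewrite ler_pdivrMr// -natrM ler_nat uphalf_half; lia.
  by move: Mle; rewrite MJ natrD; lra.
set b : R := 'C(n, M)%:R.
have b0 : 0 < b by rewrite ltr0n bin_gt0.
(* The ratio of levels i and i + 1 is (i + 1)/(n - i). For i < M it is at most (n/2 + rad)/(n/2 -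
   rad), and the upper bound on [rad] says exactly that this is less than [c]. *)
have head : \sum_(uphalf n <= i < M.+1) 'C(n, i)%:R <= (2 * c ^+ J - 1) * b.
  rewrite /b MJ; apply: (geometric_sum_le (g := fun i => 'C(n, i)%:R)) => // i.
  rewrite -MJ => /andP[_ iM]; apply: ler_bin_step; first exact: leq_trans Mn.
  have : i%:R + 1 <= M%:R :> R by rewrite natr1 ler_nat.
  nra.
(* Here 2(M + 1) - n > 2 rad by the choice of [M], and n - M <= n/2 <= c rad^2/2; the quotient is c
   rad/4. *)
have tail : \sum_(M.+1 <= i < n.+1) 'C(n, i)%:R <= c * rad / 4 * b.
  have := @upper_tail_bin_le R n M (leq_trans nM (leqW (leqnSn _))) Mn.
  set T := \sum_(M.+1 <= i < _) _ => hT.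
  have T0 : 0 <= T by apply: sumr_ge0.
  rewrite -[M.+1%:R]natr1 in Mlt.
  have nM2 : n%:R <= 2 * M%:R :> R by rewrite -natrM ler_nat mul2n.
  have lb : 2 * rad * T <= (2 * (M%:R + 1) - n%:R) * T.
    by apply: ler_wpM2r => //; lra.
  have ub : (n%:R - M%:R) * b <= c * rad ^+ 2 / 2 * b.
    by rewrite ler_pM2r//; lra.
  have := le_trans lb (le_trans hT ub).
  have -> : c * rad ^+ 2 / 2 * b = 2 * rad * (c * rad / 4 * b) by field.
  by rewrite ler_pM2l// mulr_gt0.
have total : 2 ^+ n <= 2 * ((2 * c ^+ J - 1) * b + c * rad / 4 * b).
  apply: le_trans (_ : 2 * \sum_(uphalf n <= i < n.+1) 'C(n, i)%:R <= _).
    by rewrite -natrX -natr_sum -natrM ler_nat exp2_leq_upper_half_sum.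
  rewrite (@big_cat_nat _ _ _ M.+1) //=; last by rewrite MJ; lia.
  by rewrite ler_pM2l// lerD.
have bs : b <= 'C(n, s)%:R by rewrite ler_nat leq_bin_above_half.
have E0 : 0 < expR (rad * ln c) by exact: expR_gt0.
set E := expR (rad * ln c) in E0.
have lnc : 1 / 2 <= ln c.
  have : ln (1 + (c^-1 - 1)) <= c^-1 - 1.
    by apply: le_ln1Dx; rewrite ltrBrDr addrC subrr invr_gt0.
  have : c^-1 <= 2^-1 by rewrite lef_pV2 ?posrE.
  by rewrite addrC subrK lnV ?posrE//; lra.
have cJ : c ^+ J <= E.
  rewrite -{1}(@lnK _ c) ?posrE// -expRM_natl ler_expR ler_wpM2r//; lra.
have radE : rad <= 4 * E.
  have := expR_ge1Dx (rad * ln c).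
  have : rad * (1 / 2) <= rad * ln c by rewrite ler_pM2l.
  by rewrite /E; lra.
rewrite mulrDl expRD [expR (3 * _)]expRM_natl lnK ?posrE// -/E.
apply: le_lt_trans total _.
apply: (@lt_le_trans _ _ (b * (E * c ^+ 3))); last first.
  by rewrite ler_wpM2r// mulr_ge0 ?exprn_ge0// ltW.
(* This is where the 3 in rad + 3 is spent: [total] is at most b times 4E + 2cE - 2, and c^3 - 2c -
   4 = (c - 2)(c^2 + 2c + 2). The -2, inherited from the geometric sum, makes the inequality
   strict. *)
have c3 : 2 * c + 4 <= c ^+ 3.
  have : 0 <= (c - 2) * (c ^+ 2 + 2 * c + 2) by apply: mulr_ge0; nra.
  by rewrite !exprS expr0; lra.
have h1 : c * rad <= c * (4 * E) by rewrite ler_pM2l.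
have h2 : (2 * c + 4) * E <= c ^+ 3 * E by rewrite ler_pM2r.
have h3 : 4 * c ^+ J - 2 + c * rad / 2 < E * c ^+ 3 by lra.
have -> : 2 * ((2 * c ^+ J - 1) * b + c * rad / 4 * b)
  = b * (4 * c ^+ J - 2 + c * rad / 2) by field.
by rewrite ltr_pM2l.
Qed.

(** * From the cube to a union of layers *)

Lemma hamming_setU1 n (x : 'I_n) A : (hamming (x |: A) A <= 1)%N.
Proof.
apply: leq_trans (_ : #|[set x]| <= _)%N; last by rewrite cards1.
apply: subset_leq_card; apply/subsetP => y; rewrite !inE.
by case: (y == x); case: (y \in A).
Qed.

Lemma card_layer n s : #|layer n s%:Z| = 'C(n, s).
Proof.
by rewrite -[in RHS](card_ord n) -card_draws; apply: eq_card => A; rewrite !inE eqz_nat.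
Qed.

Lemma card_layers n k (r : 'I_k -> int) : injective r ->
  #|layers n r| = (\sum_(i < k) #|layer n (r i)|)%N.
Proof.
move=> rI; rewrite -sum1_card partition_disjoint_bigcup => [|i j ij].
  by apply: eq_bigr => i _; rewrite sum1_card.
rewrite disjoints_subset; apply/subsetP => A; rewrite !inE => /eqP ->.
by apply: contra ij => /eqP /rI ->.
Qed.

Lemma layers_deviation (R : realType) (n k : nat) (c rad : R) (r : 'I_k -> int)
    (X : {set 'I_n} -> R) (h : R) :
  (2 < n)%N -> (0 < k)%N -> injective r ->
  (forall i, `|n%:R / 2 - (r i)%:~R| <= rad) -> hamming_lipschitz X -> 2 <= c ->
  rad < (c - 1) / (2 * (c + 1)) * n%:R ->
  Num.sqrt (n%:R * ln (c / (c - 1))) < rad -> 0 <= h ->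
  uniform_prob R (layers n r)
    (fun A => h <= X A - uniform_mean [set: {set 'I_n}] X)
  < expR ((rad + 3) * ln c - ln k%:R - h ^+ 2 / (2 * (n%:R - 1))).
Proof.
move=> n3 k0 rI hr hX c2 radn radsqrt h0.
have n3R : 3 <= n%:R :> R by rewrite ler_nat.
have k0R : 0 < k%:R :> R by rewrite ltr0n.
have c0 : 0 < c by lra.
have c1 : 0 < c - 1 by lra.
have rad0 : 0 < rad by apply: le_lt_trans radsqrt; rewrite sqrtr_ge0.
have lnc : 1 <= c * ln (c / (c - 1)).
  have : ln (1 + - c^-1) <= - c^-1 by apply: le_ln1Dx; rewrite ltrN2 invf_lt1//; lra.
  rewrite -[c / _]invrK lnV ?posrE ?invr_gt0 ?divr_gt0// invf_div.
  have -> : 1 - c^-1 = (c - 1) / c by field; rewrite gt_eqF.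
  by move=> /(ler_wpM2l (ltW c0)); rewrite !mulrN divff ?gt_eqF//; lra.
have nrad : n%:R <= c * rad ^+ 2.
  have : n%:R * ln (c / (c - 1)) <= rad ^+ 2.
    rewrite -[leLHS]sqr_sqrtr.
      by rewrite lerXn2r ?nnegrE ?sqrtr_ge0// ltW.
    rewrite mulr_ge0// ln_ge0// ler_pdivlMr//; lra.
  rewrite -(ler_pM2l c0); apply: le_trans.
  by rewrite mulrCA ler_peMr//.
(* Since rad < n/2, the window lies inside [0, n]: no [r i] is negative or exceeds [n], so no layer
   is empty. *)
have layerE i : exists2 s : nat, r i = s%:Z &
    (s <= n)%N /\ `|n%:R / 2 - s%:R : R| <= rad.
  have := hr i; have rn : rad < n%:R / 2.
    apply: lt_le_trans radn _.
    rewrite mulrC ler_pM2l; last by lra.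
    by rewrite ler_pdivrMr; lra.
  case: (r i) => s hs.
    exists s => //; split=> //; rewrite -(ler_nat R).
    by move: hs; rewrite ler_norml -pmulrn => /andP[]; lra.
  move: hs; rewrite NegzE ler_norml mulrNz opprK -pmulrn => /andP[].
  by have : 0 < s.+1%:R :> R by []; lra.
set E := expR ((rad + 3) * ln c).
have sizeL : k%:R * 2 ^+ n < #|layers n r|%:R * E.
  rewrite card_layers// natr_sum mulr_suml mulr_natl -[X in _ *+ X]card_ord -sumr_const.
  (* A sum of strict inequalities is strict only over a nonempty index set; [k0] supplies an
     index. *)
  apply: ltr_sum => [|i _].
    by apply/hasP; exists (Ordinal k0); rewrite // mem_index_enum.
  by have [s -> [sn hs]] := layerE i; rewrite card_layer exp2_lt_bin.
set L := #|layers n r|%:R in sizeL *.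
have E0 : 0 < E by exact: expR_gt0.
have L0 : 0 < L.
  by rewrite -(pmulr_lgt0 _ E0); apply: lt_trans sizeL; rewrite mulr_gt0// exprn_gt0.
set D := expR (- (2 * h ^+ 2 / n%:R)).
(* The deviating sets in the layers are among those of the whole cube, and the mean is already taken
   over the cube. *)
have dev : #|[set A in layers n r | h <= X A - uniform_mean [set: {set 'I_n}] X]|%:R
    <= 2 ^+ n * D.
  have lX x A : `|X (x |: A) - X A| <= 1.
    by apply: le_trans (hX _ _) _; rewrite (ler_nat R _ 1) hamming_setU1.
  have := card_deviation_hypercube _ lX h0.
  rewrite card_ord => /(_ (ltnW (ltnW n3))) dev.
  apply: le_trans dev; rewrite ler_nat subset_leq_card//.
  by apply/subsetP => A; rewrite !inE => /andP[].
rewrite /uniform_prob -/L ltr_pdivrMr//; apply: le_lt_trans dev _.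
rewrite !expRD !expRN lnK ?posrE// -/E.
(* The exponent 2h^2/n from Hoeffding dominates h^2/(2(n - 1)) because 4(n - 1) >= n. *)
have : D <= (expR (h ^+ 2 / (2 * (n%:R - 1))))^-1.
  rewrite -expRN ler_expR lerN2 ler_pdivrMr; last by lra.
  have h2 := sqr_ge0 h.
  rewrite mulrAC ler_pdivlMr; last by lra.
  by have : 0 <= h ^+ 2 * (3 * n%:R - 4); [apply: mulr_ge0 => //; lra|lra].
set D' := _^-1 => DD.
have D0 : 0 < D by exact: expR_gt0.
apply: (@le_lt_trans _ _ (2 ^+ n * D')); first by rewrite ler_pM2l// exprn_gt0.
have -> : E / k%:R * D' * L = (L * E) / k%:R * D' by ring.
rewrite ltr_pM2r; last exact: lt_le_trans DD.
by rewrite ltr_pdivlMr// mulrC.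
Qed.

Theorem theorem2p6 (R : realType) (n k : nat) (rad : R) (r : 'I_k -> int)
    (X : {set 'I_n} -> R) (hn : (3 <= n)%N) (hk : (0 < k)%N)
    (hinj : injective r)
    (hr : forall i : 'I_k, `|n%:R / 2 - (r i)%:~R| <= rad)
    (hX : hamming_lipschitz X) :
  (forall c : R, 2 <= c ->
     rad < (c - 1) / (2 * (c + 1)) * n%:R ->
     Num.sqrt (n%:R * ln (c / (c - 1))) < rad ->
     forall h : R, 0 <= h ->
       uniform_prob R (layers n r)
         (fun A => h <= X A - uniform_mean [set: {set 'I_n}] X)
       < expR ((rad + 3) * ln c - ln k%:R - h ^+ 2 / (2 * (n%:R - 1))))
  /\
  (rad < n%:R / 6 ->
     Num.sqrt (n%:R * ln 2) < rad ->
     forall h : R, 0 <= h ->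
       uniform_prob R (layers n r)
         (fun A => h <= X A - uniform_mean [set: {set 'I_n}] X)
       < expR ((rad + 3) * ln 2 - ln k%:R - h ^+ 2 / (2 * (n%:R - 1)))).
Proof.
split=> [c c2 radn radsqrt h h0|radn radsqrt h h0].
  exact: layers_deviation hX c2 radn radsqrt h0.
(* Take c = 2: the two constants become 1/6 and 2. *)
apply: layers_deviation hX _ _ _ h0 => //.
  by rewrite (_ : (2 - 1) / (2 * (2 + 1)) * n%:R = n%:R / 6 :> R)//; field.
by rewrite (_ : 2 / (2 - 1) = 2 :> R)//; field.
Qed.
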